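(* Let $(\Phi,\Delta)$ be a weakly hyperbolic based root system in a Lorentzian $(n+1)$-space $(V,B)$, with associated Coxeter group $W\subseteq \mathrm{O}_B(V)$, and fix a basis $(e_1,\dots,e_{n+1})$ of $V$ and the affine hyperplane $\mathcal H=\{x_{n+1}=1\}$ as described in the context. Then the limit set $\Lambda(W)$ of $W$, acting on the projective model $\mathbb H^n_p=Q^-\cap\mathcal H$, is equal to the set $E(\Phi)$ of limit roots of $\Phi$.
   Context: $V$ is a real vector space of dimension $n+1$ with a symmetric bilinear form $B$ of signature $(n,1)$ (a Lorentzian space); $q(v)=B(v,v)$, $Q=\{v: q(v)=0\}$, $Q^-=\{v:q(v)<0\}$. For $\alpha$ with $B(\alpha,\alpha)=1$, the $B$-reflection is $s_\alpha(v)=v-2B(\alpha,v)\alpha$. A simple system is a finite subset $\Delta\subset V$ such that: (i) $\Delta$ is positively independent (if $\sum_{\alpha\in\Delta}\lambda_\alpha\alpha=0$ with all $\lambda_\alpha\ge0$ then all $\lambda_\alpha=0$); (ii) for $\alpha\ne\beta$ in $\Delta$, $B(\alpha,\beta)\in\,]-\infty,-1]\cup\{-\cos(\pi/k):k\in\mathbb Z_{\ge2}\}$; (iii) $B(\alpha,\alpha)=1$ for all $\alpha\in\Delta$. $W$ is the subgroup of $\mathrm{O}_B(V)$ generated by $S=\{s_\alpha:\alpha\in\Delta\}$, $\Phi=W(\Delta)$ is the root system, $\Phi^+=\Phi\cap\operatorname{cone}(\Delta)$ the positive roots. The root system is weakly hyperbolic if $\operatorname{span}(\Delta)=V$. Fix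 a basis $(e_1,\dots,e_{n+1})$ of $V$ in which $q(v)=x_1^2+\dots+x_n^2-x_{n+1}^2$, such that the affine hyperplane $\mathcal H=\{x_{n+1}=1\}$ meets every line $\mathbb R\beta$, $\beta\in\Phi^+$ (transverse to $\Phi^+$), and $B(e_{n+1},\alpha)<0$ for all $\alpha\in\Delta$ (such a basis exists). For $v$ not in the linear hyperplane directing $\mathcal H$, $\widehat v$ denotes the intersection point of $\mathbb Rv$ with $\mathcal H$. The set of limit roots $E(\Phi)$ is the set of accumulation points of $\widehat\Phi=\{\widehat\beta:\beta\in\Phi\}$. The projective model $\mathbb H^n_p$ of hyperbolic $n$-space is the open unit ball $Q^-\cap\mathcal H$ (isometric via $v\mapsto v/\sqrt{|q(v)|}$ to the hyperboloid $\{q=-1,x_{n+1}>0\}$), with boundary $Q\cap\mathcal H$; $W$ acts on it by $w\cdot x=\widehat{w(x)}$, as a discrete group of hyperbolic isometries. The limit set $\Lambda(W)$ is the set of accumulation points of the orbit $W\cdot x_0$ for any $x_0\in\mathbb H^n_p$ (independent of $x_0$); it lies in $Q\cap\mathcal H$. *)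

(* Defs.v *)
From HB Require Import structures.
From mathcomp Require Import all_boot all_order all_algebra.
From mathcomp Require Import all_classical all_reals all_analysis.
Set Implicit Arguments. Unset Strict Implicit. Unset Printing Implicit Defensive.
Import Order.TTheory GRing.Theory Num.Theory.
Import numFieldNormedType.Exports.
Local Open Scope classical_set_scope.
Local Open Scope ring_scope.

Section Lorentz.
Variables (R : realType) (n : nat).
(* V = R^(n+1) as row vectors, coordinates x_1..x_{n+1} are indices 0..n;
   the last coordinate x_{n+1} is index ord_max. *)
Local Notation V := 'rV[R]_(n.+1).

Definition lsign (i : 'I_n.+1) : R := if i == ord_max then -1 else 1.
Definition Bform (u v : V) : R := \sum_(i < n.+1) lsign i * u 0 i * v 0 i.
Definition qform (v : V) : R := Bform v v.

Definition elast : V := delta_mx 0 ord_max.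
Definition xlast (v : V) : R := v 0 ord_max.

Definition refl (a v : V) : V := v - (2 * Bform a v) *: a.

(* action of the element of W written as the word ws (product of generators) *)
Definition wact (ws : seq V) (v : V) : V := foldr refl v ws.

Definition positively_independent (D : seq V) : Prop :=
  forall lam : V -> R, (forall a, a \in D -> 0 <= lam a) ->
    \sum_(a <- D) lam a *: a = 0 -> forall a, a \in D -> lam a = 0.

Definition simple_system (D : seq V) : Prop :=
  [/\ uniq D, positively_independent D,
      (forall a b, a \in D -> b \in D -> a != b ->
         Bform a b <= -1 \/
         exists k : nat, (2 <= k)%N /\ Bform a b = - cos (pi / k%:R)) &
      (forall a, a \in D -> Bform a a = 1)].

Definition cone (D : seq V) : set V :=
  [set v | exists lam : V -> R, (forall a, a \in D -> 0 <= lam a) /\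
                                v = \sum_(a <- D) lam a *: a].
Definition span_all (D : seq V) : Prop :=
  forall v : V, exists lam : V -> R, v = \sum_(a <- D) lam a *: a.

Definition roots (D : seq V) : set V :=
  [set v | exists (ws : seq V) (a : V),
      [/\ all (mem D) ws, a \in D & v = wact ws a]].
Definition pos_roots (D : seq V) : set V := roots D `&` cone D.

Definition hat (v : V) : V := (xlast v)^-1 *: v.

Definition hat_roots (D : seq V) : set V :=
  [set hat b | b in [set b | roots D b /\ xlast b != 0]].
Definition limit_roots (D : seq V) : set V := limit_point (hat_roots D).

Definition proj_model : set V := [set x | xlast x = 1 /\ qform x < 0].

Definition orbit (D : seq V) (x0 : V) : set V :=
  [set hat (wact ws x0) | ws in [set ws | all (mem D) ws]].
Definition limit_set_from (D : seq V) (x0 : V) : set V :=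
  limit_point (orbit D x0).
End Lorentz.

(* Main.v *)
Require Import Defs.
From HB Require Import structures.
From mathcomp Require Import all_boot all_order all_algebra.
From mathcomp Require Import all_classical all_reals all_analysis.
From mathcomp Require Import ring lra zify.
Import Order.TTheory GRing.Theory Num.Theory.
Import numFieldNormedType.Exports.
Local Open Scope classical_set_scope.
Local Open Scope ring_scope.

(* The last coordinate f := xlast is positive on the simple roots, so f can play
   the role of a point of the open fundamental chamber: the exchange argument
   shows that for w in W and a simple either f (w a) > 0 or w s_a is shorter
   than w, hence w = 1 as soon as f is positive on all w a. If two roots b, b'
   of bounded norm are very close, then s_b s_b' is close to the identity, so it
   is the identity and b' = b or b' = - b. Thus only finitely many roots, and
   then only finitely many vectors w x0, have bounded last coordinate. Finally
     q (hat u - hat v) = q u / (f u)^2 + q v / (f v)^2 - 2 B(u, v) / (f u f v),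
   applied to u = w a and v = w x0, where q u, q v and B(u, v) = B(a, x0) are
   bounded, shows that f (w a) large forces f (w x0) large, and then the points
   hat (w a) and hat (w x0) are close. Conversely x0 is a combination of simple
   roots, so f (w x0) large forces f (w a) large for some a. *)

(** * The Lorentzian form, its reflections, and the action of words *)

Section Reflections.
Set Implicit Arguments.
Unset Strict Implicit.
Unset Printing Implicit Defensive.
Context {R : realType} {n : nat}.
Local Notation V := 'rV[R]_(n.+1).
Implicit Types (a b u v : V) (ws : seq V).

Lemma BformC u v : Bform u v = Bform v u.
Proof. by apply: eq_bigr => i _; rewrite -!mulrA [u 0 i * _]mulrC. Qed.

Lemma BformDr u v w : Bform u (v + w) = Bform u v + Bform u w.
Proof. by rewrite -big_split; apply: eq_bigr => i _; rewrite mxE mulrDr. Qed.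

Lemma BformZr k u v : Bform u (k *: v) = k * Bform u v.
Proof. by rewrite mulr_sumr; apply: eq_bigr => i _; rewrite mxE; ring. Qed.

Lemma BformNr u v : Bform u (- v) = - Bform u v.
Proof. by rewrite -scaleN1r BformZr mulN1r. Qed.

Lemma BformBr u v w : Bform u (v - w) = Bform u v - Bform u w.
Proof. by rewrite BformDr BformNr. Qed.

Lemma BformZl k u v : Bform (k *: u) v = k * Bform u v.
Proof. by rewrite BformC BformZr BformC. Qed.

Lemma BformBl u v w : Bform (u - v) w = Bform u w - Bform v w.
Proof. by rewrite BformC BformBr !(BformC w). Qed.

Lemma Bform_elast v : Bform (elast R n) v = - xlast v.
Proof.
rewrite /Bform (bigD1 ord_max) //= big1 => [|i /negPf ne]; last first.
  by rewrite /elast mxE eqxx ne /= mulr0 mul0r.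
by rewrite /lsign /elast mxE !eqxx mulr1 mulN1r addr0.
Qed.

Lemma refl_is_linear a : linear (@refl R n a).
Proof.
move=> k u v; rewrite /refl BformDr BformZr mulrDr scalerDl scalerBr.
by rewrite !scalerA mulrCA opprD addrACA.
Qed.
HB.instance Definition _ a :=
  GRing.isLinear.Build R V V *:%R (@refl R n a) (refl_is_linear a).

Lemma wact_is_linear ws : linear (@wact R n ws).
Proof. by elim: ws => [|a ws IH] k u v //=; rewrite IH linearP. Qed.
HB.instance Definition _ ws :=
  GRing.isLinear.Build R V V *:%R (@wact R n ws) (wact_is_linear ws).

Lemma xlast_is_linear : scalar (@xlast R n).
Proof. by move=> k u v; rewrite /xlast !mxE. Qed.
HB.instance Definition _ :=
  GRing.isLinear.Build R V R *%R (@xlast R n) xlast_is_linear.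

Lemma wact_cat ws1 ws2 v : wact (ws1 ++ ws2) v = wact ws1 (wact ws2 v).
Proof. exact: foldr_cat. Qed.

Lemma refl_id a : Bform a a = 1 -> refl a a = - a.
Proof. by rewrite /refl => ->; rewrite mulr1 scaler_nat mulr2n opprD addrA subrr sub0r. Qed.

Lemma reflK a : Bform a a = 1 -> involutive (refl a).
Proof.
move=> qa v; rewrite {1}/refl BformBr BformZr qa /refl -addrA -opprD -scalerDl.
by rewrite [X in X *: _](_ : _ = 0) ?scale0r ?subr0 //; ring.
Qed.

Lemma Bform_refl a u v : Bform a a = 1 -> Bform (refl a u) (refl a v) = Bform u v.
Proof.
move=> qa; rewrite /refl !BformBl !BformBr !BformZl !BformZr qa (BformC u a); ring.
Qed.

(** Reflections are involutive isometries only for unit letters, while words are plain sequences, so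
    the condition is carried separately. *)
Definition unit_word ws := forall a, a \in ws -> Bform a a = 1.

Lemma unit_word_cons a ws : unit_word (a :: ws) -> Bform a a = 1 /\ unit_word ws.
Proof.
move=> H; split; first by apply: H; rewrite mem_head.
by move=> b bw; apply: H; rewrite inE bw orbT.
Qed.

Lemma Bform_wact ws u v : unit_word ws -> Bform (wact ws u) (wact ws v) = Bform u v.
Proof.
by elim: ws => [|a ws IH] //= /unit_word_cons [qa /IH <-]; exact: Bform_refl.
Qed.

Lemma wact_rev ws v : unit_word ws -> wact ws (wact (rev ws) v) = v.
Proof.
elim: ws v => [|a ws IH] v //= /unit_word_cons [qa uw].
by rewrite rev_cons -cats1 wact_cat IH //= reflK.
Qed.

(** Conjugation: since w is an isometry, s_(w a) = w s_a w^-1, so the reflection in any root is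
    itself given by a word. *)
Lemma refl_wact ws a v : unit_word ws ->
  refl (wact ws a) v = wact (ws ++ a :: rev ws) v.
Proof.
move=> uw; rewrite wact_cat /= {2}/refl linearB linearZ /= wact_rev // /refl.
by rewrite -(Bform_wact a _ uw) wact_rev.
Qed.

(** * Dihedral groups and Chebyshev polynomials *)

(* The alternating word ... a b of length [k] whose last letter is [b]. *)
Fixpoint altw a b k : seq V :=
  if k is k'.+1 then (if odd k' then a else b) :: altw a b k' else [::].

Lemma size_altw a b k : size (altw a b k) = k.
Proof. by elim: k => //= k ->. Qed.

Lemma altw_sub a b k : {subset altw a b k <= [:: a; b]}.
Proof.
elim: k => //= k IH x; rewrite inE => /orP[/eqP ->|/IH //].
by case: ifP; rewrite !inE eqxx ?orbT.
Qed.

Lemma altwSr a b k : altw a b k.+1 = rcons (altw b a k) b.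
Proof.
elim: k => // k IH.
by rewrite [LHS]/= -/(altw a b k.+1) IH [altw b a _]/= rcons_cons; case: (odd k).
Qed.

Lemma altw_addn a b m k : exists2 ws, altw a b (k + m) = ws ++ altw a b m &
  size ws = k /\ {subset ws <= [:: a; b]}.
Proof.
elim: k => [|k [ws e [sz sub]]]; first by exists [::].
exists ((if odd (k + m) then a else b) :: ws); first by rewrite addSn /= e.
split; first by rewrite /= sz.
move=> x; rewrite inE => /orP[/eqP ->|/sub //].
by case: ifP; rewrite !inE eqxx ?orbT.
Qed.

(** Equal adjacent letters cancel, so a word in two letters reduces to an alternating one. *)
Lemma wact_alt a b ws : Bform a a = 1 -> Bform b b = 1 -> {subset ws <= [:: a; b]} ->
  exists k, (k <= size ws)%N /\
    (wact ws =1 wact (altw a b k) \/ wact ws =1 wact (altw b a k)).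
Proof.
move=> qa qb; elim: ws => [_|x ws IH sub]; first by exists 0%N; split => //; left.
have [] := IH; first by move=> y yw; apply: sub; rewrite inE yw orbT.
move=> k [kle H].
have step y z : Bform y y = 1 -> Bform z z = 1 -> x \in [:: y; z] ->
    wact ws =1 wact (altw y z k) ->
    exists k0, (k0 <= size (x :: ws))%N /\ (wact (x :: ws) =1 wact (altw y z k0) \/
      wact (x :: ws) =1 wact (altw z y k0)).
  move=> qy qz xyz e.
  have [->|ne] := eqVneq x (if odd k then y else z).
    by exists k.+1; split => //; left => v /=; rewrite e.
  (* The empty word has no first letter to cancel; there [x = y], and the one-letter word is
     [altw z y 1]. *)
  case: k kle e ne {H} => [|k] kle e ne.
    exists 1%N; split => //; right => v /=; rewrite e /=.
    by move: xyz ne; rewrite !inE /= => /orP[/eqP ->|->].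
  exists k; split; first by rewrite ltnW // ltnS ltnW.
  left => v /=; rewrite e /= in ne *.
  have -> : x = if odd k then y else z.
    by move: xyz ne; rewrite !inE /=; case: (odd k) => /= /orP[]/eqP-> //; rewrite eqxx.
  by rewrite reflK //; case: ifP.
have xab : x \in [:: a; b] by apply: sub; rewrite mem_head.
case: H => H; first exact: step H.
have [|k0 [le [] e]] := step b a qb qa _ H.
- by move: xab; rewrite !inE orbC.
- by exists k0; split => //; right.
- by exists k0; split => //; left.
Qed.

(* [chebU c k] is the Chebyshev polynomial U_(k-1) at [c], with U_(-1) = 0. *)
Fixpoint chebU (c : R) k : R :=
  match k with
  | 0 => 0
  | k'.+1 => if k' is k''.+1 then 2 * c * chebU c k' - chebU c k'' else 1
  end.

Arguments chebU : simpl never.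

Lemma chebU0 c : chebU c 0 = 0. Proof. by []. Qed.

Lemma chebU1 c : chebU c 1 = 1. Proof. by []. Qed.

Lemma chebUSS c k : chebU c k.+2 = 2 * c * chebU c k.+1 - chebU c k.
Proof. by []. Qed.

(** Meant for B(a, b) <= -1, the infinite dihedral case: when c >= 1 the increments of [chebU c]
    never fall below the first one, which is 1. *)
Lemma chebU_incr c k : 1 <= c -> 0 <= chebU c k /\ chebU c k + 1 <= chebU c k.+1.
Proof.
move=> c1; elim: k => [|k [IH1 IH2]]; first by rewrite chebU0 chebU1 add0r.
rewrite chebUSS; split; nra.
Qed.

Lemma chebU_cos (x : R) k : chebU (cos x) k * sin x = sin (k%:R * x).
Proof.
suff : chebU (cos x) k * sin x = sin (k%:R * x) /\
       chebU (cos x) k.+1 * sin x = sin (k.+1%:R * x) by case.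
elim: k => [|k [IH1 IH2]]; first by rewrite chebU0 chebU1 !mul0r sin0 !mul1r.
split => //.
transitivity (2 * cos x * (chebU (cos x) k.+1 * sin x) - chebU (cos x) k * sin x).
  by rewrite chebUSS mulrBl mulrA.
rewrite IH1 IH2.
have -> : k.+2%:R * x = k.+1%:R * x + x by rewrite -natr1 mulrDl mul1r.
have -> : k%:R * x = k.+1%:R * x - x by rewrite -natr1 mulrDl mul1r addrK.
by rewrite sinB sinD; ring.
Qed.

(** The next letter carries the coefficient [chebU c k]; reflecting in it turns this into
    [2 * c * chebU c k.+1 - chebU c k], which is the Chebyshev recurrence. *)
Lemma wact_altw a b k : Bform a a = 1 -> Bform b b = 1 ->
  let c := - Bform a b in
  wact (altw a b k) a =
    chebU c k.+1 *: (if odd k then b else a) + chebU c k *: (if odd k then a else b).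
Proof.
move=> qa qb c; elim: k => [|k IH]; first by rewrite /= chebU0 chebU1 scale1r scale0r addr0.
rewrite [LHS]/= -/(altw a b k) IH linearD !linearZ /=.
rewrite chebUSS /c; case: (odd k) => /=.
  rewrite refl_id // /refl.
  by apply/rowP => i; rewrite !mxE; ring.
rewrite refl_id // /refl (BformC b a).
by apply/rowP => i; rewrite !mxE; ring.
Qed.

Lemma sin_pi_div (m : nat) : (2 <= m)%N ->
  0 < sin (pi / m%:R : R) /\ (forall k, (k <= m)%N -> 0 <= sin (k%:R * (pi / m%:R) : R)) /\
  (forall k, (0 < k < m)%N -> 0 < sin (k%:R * (pi / m%:R) : R)).
Proof.
move=> m2; have m0 : 0 < m%:R :> R by rewrite ltr0n; lia.
have pi0 := pi_gt0 R.
have H k : (0 < k < m)%N -> 0 < sin (k%:R * (pi / m%:R) : R).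
  move=> /andP[k0 km]; apply: sin_gt0_pi; rewrite mulr_gt0 ?divr_gt0 //= ?ltr0n //.
  by rewrite mulrCA gtr_pMr // ltr_pdivrMr // mul1r ltr_nat.
split; first by rewrite -[pi / _]mul1r; apply: (H 1%N); lia.
split => // k; rewrite leq_eqVlt => /orP[/eqP->|km].
  by rewrite mulrC divfK ?gt_eqF // sinpi.
by case: k km => [|k] km; [rewrite mul0r sin0 | apply/ltW/H].
Qed.

(* The braid relation: the reflections in [a] and [b] fix the orthogonal of the
   nondegenerate plane <a, b>, on which both words are computed by [wact_altw]. *)
Lemma altw_braid a b (m : nat) : Bform a a = 1 -> Bform b b = 1 -> (2 <= m)%N ->
  Bform a b = - cos (pi / m%:R) -> wact (altw a b m) =1 wact (altw b a m).
Proof.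
move=> qa qb m2 Bab; have [s0 _] := sin_pi_div m2.
set c := cos (pi / m%:R) in Bab; set s := sin (pi / m%:R) in s0.
have m0 : m%:R != 0 :> R by rewrite pnatr_eq0; lia.
have csE : c ^+ 2 + s ^+ 2 = 1 by exact: cos2Dsin2.
have UE k : chebU c k = sin (k%:R * (pi / m%:R)) / s.
  by rewrite -chebU_cos mulfK ?gt_eqF.
have mE : m%:R * (pi / m%:R) = pi :> R by rewrite mulrC divfK.
have Um : chebU c m = 0 by rewrite UE mE sinpi mul0r.
have Um1 : chebU c m.+1 = -1.
  by rewrite UE -natr1 mulrDl mul1r mE addrC sinDpi -/s mulNr divff ?gt_eqF.
have m1 : m.-1.+1 = m := prednK (ltnW m2).
have Um_1 : chebU c m.-1 = 1.
  by have := chebUSS c m.-1; rewrite m1 Um Um1 mulr0 sub0r => /oppr_inj ->.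
(* The word [altw y x m] ends in x and s_x x = - x, so both sides are read off from the values of
   [chebU c] at m-1, m and m+1. *)
have key x y : Bform x x = 1 -> Bform y y = 1 -> Bform x y = - c ->
    wact (altw x y m) x = wact (altw y x m) x.
  move=> qx qy Bxy; have -> : altw y x m = rcons (altw x y m.-1) x by rewrite -{1}m1 altwSr.
  have om : odd m = ~~ odd m.-1 by rewrite -{1}m1.
  rewrite -cats1 wact_cat /= refl_id // linearN /= !wact_altw // Bxy opprK m1.
  by rewrite Um1 Um Um_1 !scale0r addr0 add0r scale1r scaleN1r om; case: (odd m.-1).
(* The Gram determinant 1 - c^2 is sin^2(pi/m), nonzero as m >= 2. Below, x and y are the
   coordinates of the projection of v to the plane. *)
move=> v; have s2 : 1 - c ^+ 2 != 0 by rewrite -csE [c^+2 + _]addrC addrK expf_neq0 ?gt_eqF.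
set x := (Bform a v + c * Bform b v) / (1 - c ^+ 2).
set y := (Bform b v + c * Bform a v) / (1 - c ^+ 2).
pose v0 := v - x *: a - y *: b.
have va : Bform a v0 = 0.
  by rewrite !BformBr !BformZr qa Bab /x /y; field.
have vb : Bform b v0 = 0.
  by rewrite !BformBr !BformZr qb (BformC b a) Bab /x /y; field.
have fix0 d e k : Bform d v0 = 0 -> Bform e v0 = 0 -> wact (altw d e k) v0 = v0.
  move=> dv ev; elim: k => //= k ->.
  by case: ifP; rewrite /refl ?dv ?ev mulr0 scale0r subr0.
have ve : v0 + x *: a + y *: b = v by rewrite /v0 addrAC !subrK.
clearbody v0; rewrite -ve.
rewrite !linearD !linearZ /= !fix0 // (key a b) // (key b a) //.
by rewrite BformC.
Qed.

Lemma nonneg_comb_gt0 (x y p q : R) :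
  0 <= x -> 0 <= y -> 0 < x + y -> 0 < p -> 0 < q -> 0 < x * p + y * q.
Proof.
move=> x0 y0 xy p0 q0; have [xp|xn] := ltP 0 x.
  by rewrite ltr_pwDl ?mulr_gt0 // mulr_ge0 // ltW.
have -> : x = 0 by apply/le_anti; rewrite xn.
by rewrite mul0r add0r mulr_gt0 //; lra.
Qed.

Definition Coxeter_pair a b := Bform a b <= -1 \/
  exists k : nat, (2 <= k)%N /\ Bform a b = - cos (pi / k%:R).

(** Reduce to an alternating word. If it ends in a, delete that letter. If it ends in b, the
    coefficients of the image of a are Chebyshev values, nonnegative as long as the length is below
    the order m; from m on, the braid relation makes the word end in a. *)
Lemma dihedral_exchange a b ws : Bform a a = 1 -> Bform b b = 1 -> Coxeter_pair a b ->
  {subset ws <= [:: a; b]} ->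
  (exists x y, [/\ 0 <= x, 0 <= y, 0 < x + y & wact ws a = x *: a + y *: b]) \/
  (exists ws', [/\ {subset ws' <= [:: a; b]}, (size ws' < size ws)%N &
     wact ws' =1 wact ws \o refl a]).
Proof.
move=> qa qb cox sub; have [k [kle [] e]] := wact_alt qa qb sub; last first.
  case: k kle e => [|k] kle e.
    by left; exists 1, 0; rewrite e /= scale1r scale0r !addr0; split.
  right; exists (altw a b k); rewrite size_altw; split => //; first exact: altw_sub.
  by move=> v; rewrite /= e altwSr -cats1 wact_cat /= reflK.
have pos : 0 <= chebU (- Bform a b) k.+1 -> 0 <= chebU (- Bform a b) k ->
    0 < chebU (- Bform a b) k.+1 + chebU (- Bform a b) k ->
    exists x y, [/\ 0 <= x, 0 <= y, 0 < x + y & wact ws a = x *: a + y *: b].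
  move=> U1 U0 U01; rewrite e wact_altw //.
  set U' := chebU _ k.+1 in U1 U01 *; set U := chebU _ k in U0 U01 *.
  case: (odd k); last by exists U', U.
  by exists U, U'; rewrite [U + U']addrC [U *: a + _]addrC; split.
case: cox => [le1|[m [m2 Bab]]].
  have c1 : 1 <= - Bform a b by rewrite lerNr.
  by have [U0 U1] := chebU_incr k c1; left; apply: pos; lra.
have [s0 [sge sgt]] := sin_pi_div m2.
have [km|mk] := ltnP k m; last first.
  right; have [pre pe [sz psub]] := altw_addn a b m (k - m).
  exists (pre ++ altw a b m.-1); split.
  - by move=> x; rewrite mem_cat => /orP[/psub|/altw_sub].
  - rewrite size_cat size_altw sz; lia.
  move=> v; rewrite /= e -(subnK mk) pe !wact_cat (altw_braid qa qb m2 Bab).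
  by rewrite -{2}(prednK (ltnW m2)) altwSr -cats1 wact_cat /= reflK.
left; apply: pos; rewrite Bab opprK.
- by rewrite -(pmulr_lge0 _ s0) chebU_cos sge.
- by rewrite -(pmulr_lge0 _ s0) chebU_cos sge // ltnW.
(* At k = m-1 the first sine vanishes and at k = 0 the second does, but never both. *)
rewrite -(pmulr_lgt0 _ s0) mulrDl !chebU_cos.
case: k km {kle e} => [|k] km; first by rewrite !mul1r mul0r sin0 addr0.
by rewrite ltr_wpDl ?sge ?sgt.
Qed.

Lemma refl_eq b b' : Bform b b = 1 -> Bform b' b' = 1 -> refl b =1 refl b' ->
  b' = b \/ b' = - b.
Proof.
move=> qb qb' /(_ b); rewrite refl_id // /refl => e.
have {}e : b = Bform b' b *: b'.
  by apply/rowP => i; have := congr1 (fun w : V => w 0 i) e; rewrite !mxE; lra.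
have : Bform b' b ^+ 2 = 1 by rewrite expr2 -BformZl -e.
move/eqP; rewrite sqrf_eq1 => /orP[]/eqP h; rewrite h in e.
  by left; rewrite e scale1r.
by right; rewrite e scaleN1r opprK.
Qed.

(** * Sup norm estimates, and finiteness by compactness *)

Lemma coord_le_norm v i : `|v 0 i| <= `|v|.
Proof.
rewrite [leRHS]mx_normrE.
by apply/bigmax_geP; right => /=; exists (0, i).
Qed.

Lemma norm_attained v : exists i, `|v| = `|v 0 i|.
Proof.
have [v0|/mx_norm_neq0 [[j i] e]] := eqVneq (`|v|) 0.
  exists ord0; rewrite v0; apply/esym/eqP; rewrite -normr_le0 normr_id.
  by rewrite -v0 coord_le_norm.
by exists i; rewrite [LHS]e /= (ord1 j).
Qed.

Lemma norm_Bform u v : `|Bform u v| <= n.+1%:R * (`|u| * `|v|).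
Proof.
apply: le_trans (ler_norm_sum _ _ _) _.
apply: (@le_trans _ _ (\sum_(i < n.+1) `|u| * `|v|)); last first.
  by rewrite sumr_const card_ord -[X in X <= _]mulr_natl lexx.
apply: ler_sum => i _; rewrite !normrM.
have -> : `|lsign R i| = 1 by rewrite /lsign; case: ifP => _; rewrite ?normrN normr1.
by rewrite mul1r ler_pM ?coord_le_norm.
Qed.

(** The right side is the squared Euclidean norm. Thus q and the last coordinate together control
    the norm. *)
Lemma norm_sqr_le v : `|v| ^+ 2 <= qform v + 2 * xlast v ^+ 2.
Proof.
have [i ->] := norm_attained v; rewrite real_normK ?num_real //.
have -> : qform v + 2 * xlast v ^+ 2 = \sum_(j < n.+1) v 0 j ^+ 2.
  rewrite /qform /Bform (bigD1 ord_max) //= [RHS](bigD1 ord_max) //=.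
  rewrite /lsign eqxx /xlast (eq_bigr (fun j => v 0 j ^+ 2)); first by ring.
  by move=> j /negPf ->; rewrite mul1r expr2.
rewrite (bigD1 i) //= lerDl sumr_ge0 // => j _; exact: sqr_ge0.
Qed.

Lemma uniform_small (f g : V -> R) (s : seq V) : (forall a, a \in s -> 0 < f a) ->
  exists2 e, 0 < e & forall a d, a \in s -> 0 <= d < e -> d * g a < f a.
Proof.
elim: s => [_|a s IH pos]; first by exists 1.
have [|e e0 He] := IH; first by move=> b bs; apply: pos; rewrite inE bs orbT.
have fa : 0 < f a by apply: pos; rewrite mem_head.
have g1 : 0 < `|g a| + 1 by rewrite ltr_wpDl.
exists (Num.min e (f a / (`|g a| + 1))); first by rewrite lt_min e0 divr_gt0.
move=> b d; rewrite inE lt_min => /orP[/eqP ->|bs] /and3P[d0 de]; last first.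
  by move=> _; apply: He => //; rewrite d0.
rewrite ltr_pdivlMr // => h; apply: le_lt_trans h.
by apply: ler_wpM2l => //; have := ler_norm (g a); lra.
Qed.

(** Finitely many balls of radius e/2 cover the compact ball of radius K, and each holds at most one
    pair b, - b of A. *)
Lemma separated_finite (A : set V) (K e : R) : 0 < e -> (forall b, A b -> `|b| <= K) ->
  (forall b b', A b -> A b' -> `|b - b'| < e -> b' = b \/ b' = - b) -> finite_set A.
Proof.
move=> e0 AK sep.
have cK : compact [set v : V | `|v| <= K].
  apply: bounded_closed_compact.
    by exists K; split; rewrite ?num_real // => M KM v /= /le_trans; apply; exact: ltW.
  rewrite (_ : [set v : V | _] = (@Num.norm R V) @^-1` [set x | x <= K]) //.
  apply: closed_comp; last exact: closed_le.
  by move=> v _; exact: norm_continuous.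
rewrite compact_cover in cK.
have [||F _ cov] := cK V setT (fun x : V => ball x (e / 2)).
- by move=> x _; exact: ball_open.
- by move=> x _; exists x => //; apply: ballxx; lra.
have finF := finite_fset F; set G := (X in cover X) in cov.
have sA : A `<=` \bigcup_(x in G) (A `&` ball x (e / 2)).
  by move=> b Ab; have [x Fx xb] := cov _ (AK _ Ab); exists x.
apply: (sub_finite_set sA); apply: bigcup_finite => [|x _]; first exact: finF.
have [[b [Ab xb]]|no] := pselect (exists b, (A `&` ball x (e / 2)) b); last first.
  by apply: (@sub_finite_set _ _ set0) => // b Hb; apply: no; exists b.
apply: (@sub_finite_set _ _ [set b; - b]); last exact: finite_set2.
move=> b' [Ab' xb']; have /= := sep b b' Ab Ab'.
case=> [|->|->]; [|by left|by right].
move: xb xb'; rewrite -ball_normE /ball_ /= => xb xb'.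
have -> : b - b' = (x - b') - (x - b) by rewrite opprB [RHS]addrC subrKA.
by apply: le_lt_trans (ler_normB _ _) _; lra.
Qed.

End Reflections.

(** * The exchange property and discreteness of the roots *)

Section Coxeter.
Set Implicit Arguments.
Unset Strict Implicit.
Unset Printing Implicit Defensive.
Context {R : realType} {n : nat}.
Local Notation V := 'rV[R]_(n.+1).
Variable D : seq V.
Hypothesis D_unit : forall a, a \in D -> Bform a a = 1.
Hypothesis D_cox : forall a b, a \in D -> b \in D -> a != b -> Coxeter_pair a b.
Hypothesis D_pos : forall a, a \in D -> 0 < xlast a.
Implicit Types (a b u v : V) (ws : seq V).

Lemma sub_unit_word ws : {subset ws <= D} -> unit_word ws.
Proof. by move=> sub a /sub; exact: D_unit. Qed.

(* Factor [ws = vs ++ us] with [us] in the dihedral group of [a] and its last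
   letter [t], and push letters [a], [t] from the end of [vs] into [us] as long
   as that shortens [vs]: then [vs] maps both [a] and [t] to positive roots and
   [dihedral_exchange] applies to [us]. *)
Lemma exchange ws a : {subset ws <= D} -> a \in D ->
  0 < xlast (wact ws a) \/
  (exists ws', [/\ {subset ws' <= D}, (size ws' < size ws)%N &
     wact ws' =1 wact ws \o refl a]).
Proof.
have [k] := ubnP (size ws); elim: k ws a => // k IH ws a; rewrite ltnS => szk sub aD.
case/lastP: ws szk sub => [_ _|ws t]; first by left; exact: D_pos.
rewrite size_rcons => szk sub.
have tD : t \in D by apply: sub; rewrite mem_rcons mem_head.
have sub' : {subset ws <= D} by move=> x xw; apply: sub; rewrite mem_rcons inE xw orbT.
have [ta|ta] := eqVneq a t.
  right; exists ws; split => //.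
  by move=> v; rewrite /= ta -cats1 wact_cat /= reflK ?D_unit.
have abD : {subset [:: a; t] <= D} by move=> x; rewrite !inE => /orP[]/eqP->.
suff inner j vs us : (size vs < j)%N -> (size vs + size us <= (size ws).+1)%N ->
    (size vs < k)%N ->
    {subset vs <= D} -> {subset us <= [:: a; t]} ->
    wact (rcons ws t) =1 wact vs \o wact us ->
    0 < xlast (wact (rcons ws t) a) \/ exists ws', [/\ {subset ws' <= D},
      (size ws' < (size ws).+1)%N & wact ws' =1 wact (rcons ws t) \o refl a].
  apply: (inner (size ws).+1 ws [:: t]) => //=.
  - by rewrite addn1.
  - by move=> x; rewrite !inE => ->; rewrite orbT.
  - by move=> v; rewrite -cats1 wact_cat.
elim: j vs us => // j IHj vs us szj szs vk vD usub e.
(* The outer induction applies to [vs]: either x stays positive, or x moves into [us], [vs] gets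
   shorter and the inner induction concludes. *)
have push x : x \in [:: a; t] -> 0 < xlast (wact vs x) \/
    (0 < xlast (wact (rcons ws t) a) \/ exists ws', [/\ {subset ws' <= D},
      (size ws' < (size ws).+1)%N & wact ws' =1 wact (rcons ws t) \o refl a]).
  move=> xat; have xD := abD _ xat.
  case: (IH vs x vk vD xD) => [|[vs' [vs'D vs'sz vs'e]]]; first by left.
  right; apply: (IHj vs' (x :: us)) => //=.
  - exact: leq_trans vs'sz szj.
  - by rewrite addnS -addSn; apply: leq_trans szs; rewrite leq_add2r.
  - exact: ltn_trans vs'sz vk.
  - by move=> y; rewrite inE => /orP[/eqP->|/usub].
  - by move=> v; rewrite /= vs'e /= reflK ?D_unit.
have [pa|//] := push a (mem_head _ _).
have tat : t \in [:: a; t] by rewrite !inE eqxx orbT.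
have [pt|//] := push t tat.
have := dihedral_exchange (D_unit aD) (D_unit tD) (D_cox aD tD ta) usub.
case=> [[x [y [x0 y0 xy ea]]]|[us' [us'D us'sz us'e]]].
  left; rewrite e /= ea !linearD !linearZ /=.
  exact: nonneg_comb_gt0.
right; exists (vs ++ us'); split.
- by move=> x; rewrite mem_cat => /orP[/vD|/us'D /abD].
- by rewrite size_cat; apply: leq_trans szs; rewrite ltn_add2l.
- by move=> v; rewrite wact_cat us'e /= e.
Qed.

(** If the word ends in t, the prefix sends t to a vector with negative last coordinate, so
    [exchange] gives a shorter word with the same action. *)
Lemma wact_eq_id ws : {subset ws <= D} ->
  (forall a, a \in D -> 0 < xlast (wact ws a)) -> wact ws =1 id.
Proof.
have [k] := ubnP (size ws); elim: k ws => // k IH ws; rewrite ltnS => szk sub pos.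
case/lastP: ws szk sub pos => [//|ws t]; rewrite size_rcons => szk sub pos.
have tD : t \in D by apply: sub; rewrite mem_rcons mem_head.
have sub' : {subset ws <= D} by move=> x xw; apply: sub; rewrite mem_rcons inE xw orbT.
have neg : 0 < - xlast (wact ws t).
  by have := pos t tD; rewrite -cats1 wact_cat /= refl_id ?D_unit // !linearN.
have [p|[ws' [ws'D ws'sz ws'e]]] := exchange sub' tD; first by lra.
have e : wact ws' =1 wact (rcons ws t) by move=> v; rewrite ws'e -cats1 wact_cat.
move=> v; rewrite -e.
apply: IH => //; first exact: ltn_trans ws'sz szk.
by move=> a aD; rewrite e; exact: pos.
Qed.

Lemma roots_unit b : Defs.roots D b -> Bform b b = 1.
Proof.
case=> ws [a [/allP wD aD ->]]; rewrite Bform_wact ?D_unit //.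
exact: sub_unit_word.
Qed.

Lemma refl_root b : Defs.roots D b -> exists2 ws, {subset ws <= D} & refl b =1 wact ws.
Proof.
case=> ws [a [/allP wD aD ->]]; exists (ws ++ a :: rev ws).
  by move=> x; rewrite mem_cat inE mem_rev => /or3P[/wD//|/eqP->//|/wD].
by move=> v; apply/refl_wact/sub_unit_word.
Qed.

(* If the roots [b], [b'] are close, then [refl b' \o refl b] is an element of
   the group close to the identity, hence keeps the simple roots positive. *)
Lemma roots_separated (K : R) : 0 < K -> exists2 e, 0 < e &
  forall b b', Defs.roots D b -> Defs.roots D b' -> `|b| <= K -> `|b'| <= K -> `|b - b'| < e ->
    b' = b \/ b' = - b.
Proof.
move=> K0; set N : R := n.+1%:R; have N0 : 0 < N by rewrite ltr0n.
(* The first factor times |b - b'| bounds |s_b a - s_b' a|; the second bounds the effect of s_b' on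
   the last coordinate. *)
have [e e0 He] := uniform_small
  (fun a => (4 * N * K * `|a|) * (1 + 2 * N * K ^+ 2)) D_pos.
exists e => // b b' rb rb' bK b'K be.
apply: refl_eq; [exact: roots_unit| exact: roots_unit|].
have [ws wD we] := refl_root rb; have [ws' wD' we'] := refl_root rb'.
have q' := roots_unit rb'.
suff id1 : wact (ws' ++ ws) =1 id.
  by move=> v; rewrite -[RHS](congr1 (refl b') (id1 v)) wact_cat -we -we' reflK.
apply: wact_eq_id => [x|a aD]; first by rewrite mem_cat => /orP[/wD'|/wD].
rewrite wact_cat -we -we'.
(* Then s_b' s_b a = a + s_b' z, so it suffices that the last coordinate of s_b' z is smaller than
   that of a. *)
have [z zd] : exists z, z = refl b a - refl b' a by eexists.
have -> : refl b a = z + refl b' a by rewrite zd subrK.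
rewrite (linearD (refl b')) /= reflK // linearD /=; set d := b - b' in be.
have zE : z = - 2 *: (Bform d a *: b + Bform b' a *: d).
  rewrite zd /refl /d BformBl; apply/rowP => i; rewrite !mxE; ring.
have nd : 0 <= `|d| by []. have na : 0 <= `|a| by [].
have zn : `|z| <= 4 * N * K * `|a| * `|d|.
  rewrite zE normrZ normrN ger0_norm //.
  apply: (@le_trans _ _ (2 * ((N * (`|d| * `|a|)) * K + (N * (K * `|a|)) * `|d|))); last by lra.
  rewrite ler_pM2l //; apply: le_trans (ler_normD _ _) _; rewrite !normrZ.
  apply: lerD; apply: ler_pM => //; first exact: norm_Bform.
  apply: le_trans (norm_Bform _ _) _; rewrite ler_pM2l //.
  exact: ler_wpM2r.
have rn : `|xlast (refl b' z)| <= `|z| * (1 + 2 * N * K ^+ 2).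
  rewrite /refl linearB linearZ /=; apply: le_trans (ler_normB _ _) _.
  rewrite mulrDr mulr1; apply: lerD; first exact: coord_le_norm.
  rewrite !normrM (ger0_norm (_ : 0 <= 2)) //.
  have -> : `|z| * (2 * N * K ^+ 2) = 2 * (N * (K * `|z|)) * K by ring.
  apply: ler_pM => //.
    rewrite ler_pM2l //; apply: le_trans (norm_Bform _ _) _; rewrite ler_pM2l //.
    exact: ler_wpM2r.
  exact: le_trans (coord_le_norm _ _) b'K.
have := He a `|d| aD; rewrite nd be => /(_ isT) h.
have : `|xlast (refl b' z)| < xlast a.
  apply: le_lt_trans rn _; apply: le_lt_trans h.
  have -> : `|d| * ((4 * N * K * `|a|) * (1 + 2 * N * K ^+ 2)) =
    (4 * N * K * `|a| * `|d|) * (1 + 2 * N * K ^+ 2) by ring.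
  apply: ler_wpM2r => //; nra.
by rewrite ltr_norml => /andP[]; lra.
Qed.

Lemma roots_finite (M : R) : finite_set [set b | Defs.roots D b /\ `|xlast b| <= M].
Proof.
(* By [norm_sqr_le], |b|^2 <= K, and as K >= 1 this also gives |b| <= K. *)
pose K := 1 + 2 * M ^+ 2; have K1 : 1 <= K by rewrite /K; have := sqr_ge0 M; lra.
have K0 : 0 < K by lra.
have [e e0 sep] := roots_separated K0.
have bd b : Defs.roots D b /\ `|xlast b| <= M -> `|b| <= K.
  move=> [rb bM]; have := norm_sqr_le b; rewrite /qform roots_unit // => h.
  have : xlast b ^+ 2 <= M ^+ 2.
    by rewrite -[xlast b ^+ 2]real_normK ?num_real // lerXn2r ?nnegrE // (le_trans _ bM).
  move=> h2; rewrite leNgt; apply/negP => Kb.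
  by rewrite /K in K1 Kb *; nra.
apply: (separated_finite e0 bd) => b b' H H'.
by apply: sep; [case: H|case: H'|exact: bd|exact: bd].
Qed.

End Coxeter.

(** * Limit points of projected sets *)

Section LimitPoints.
Set Implicit Arguments.
Unset Strict Implicit.
Unset Printing Implicit Defensive.
Context {R : realType} {n : nat}.
Local Notation V := 'rV[R]_(n.+1).
Implicit Types (a b u v x : V).

(** A finite set without x is closed, so removing it from a ball around x leaves a neighbourhood of
    x. *)
Lemma limit_point_avoid (A F : set V) x (e : R) : finite_set F -> 0 < e ->
  limit_point A x -> exists y, [/\ y != x, A y, ~ F y & `|y - x| < e].
Proof.
move=> finF e0 lim.
have cl : closed (F `\ x).
  apply: (accessible_finite_set_closed.1 (hausdorff_accessible (@norm_hausdorff _ V))).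
  exact: finite_setD.
have nU : nbhs x (ball x e `&` ~` (F `\ x)).
  apply: filterI; first exact: nbhsx_ballx.
  by apply: open_nbhs_nbhs; split; [exact: closed_openC | case=> _; apply].
have [y [yx Ay [xy nF]]] := lim _ nU.
exists y; split => //; first by move=> Fy; apply: nF; split => //; exact/eqP.
by move: xy; rewrite -ball_normE /ball_ /= distrC.
Qed.

Lemma qform_hat u : qform (hat u) = qform u / xlast u ^+ 2.
Proof. by rewrite /qform /hat BformZl BformZr expr2 invfM; ring. Qed.

(** The difference has last coordinate 0, so [norm_sqr_le] bounds its squared norm by q, which is
    then expanded. *)
Lemma norm_hat_sub u v : xlast u != 0 -> xlast v != 0 ->
  `|hat u - hat v| ^+ 2 <= qform u / xlast u ^+ 2 + qform v / xlast v ^+ 2 -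
     2 * (Bform u v / (xlast u * xlast v)).
Proof.
move=> u0 v0; apply: le_trans (norm_sqr_le _) _.
have -> : xlast (hat u - hat v) = 0.
  by rewrite /hat /xlast !mxE -/(xlast u) -/(xlast v) !mulVf // subrr.
rewrite expr0n /= mulr0 addr0 /qform /hat BformBl !BformBr !BformZl !BformZr (BformC v u).
by rewrite le_eqVlt; apply/orP; left; apply/eqP; field; rewrite u0 v0.
Qed.

Lemma norm_qform_sub u v : `|u - v| < 1 ->
  `|qform u - qform v| <= n.+1%:R * (2 * `|v| + 1) * `|u - v|.
Proof.
move=> uv; have -> : qform u - qform v = Bform (u - v) (u + v).
  by rewrite /qform BformBl !BformDr (BformC v u); ring.
apply: le_trans (norm_Bform _ _) _; rewrite -mulrA ler_pM2l ?ltr0n // mulrC.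
apply: ler_wpM2r => //.
have -> : u + v = (u - v) + (v + v) by rewrite addrA subrK.
apply: le_trans (ler_normD _ _) _; have := ler_normD v v; lra.
Qed.

(* By [norm_hat_sub], [hat u] and [hat v] are close as soon as both [xlast u]
   and [xlast v] are large. *)
Lemma limit_point_transfer (X Y : set V) (c d b r : R) : 0 < r -> d != 0 ->
  (forall u, X u -> xlast u != 0 /\ qform u = c) -> (forall v, Y v -> qform v = d) ->
  (forall M : R, finite_set [set u | X u /\ `|xlast u| <= M]) ->
  (forall u, X u -> exists v, [/\ Y v, r * `|xlast u| <= `|xlast v| & `|Bform u v| <= b]) ->
  limit_point ((@hat R n) @` X) `<=` limit_point ((@hat R n) @` [set v | Y v /\ xlast v != 0]).
Proof.
move=> r0 d0 Xc Yd fin part x lim.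
have far (M e : R) : 0 < e -> exists u, [/\ X u, M < `|xlast u| & `|hat u - x| < e].
  move=> e0; have [_ [_ [u Xu <-] nF ux]] :=
    limit_point_avoid (finite_image (@hat R n) (fin M)) e0 lim.
  exists u; split => //; rewrite ltNge; apply/negP => uM; apply: nF; by exists u.
(* Limit points are isotropic: q(hat u) = c / (xlast u)^2 tends to 0 along the vectors given by
   [far]. *)
have qx : qform x = 0.
  apply/eqP; rewrite -normr_eq0 eq_le normr_ge0 andbT leNgt; apply/negP.
  set q := `|qform x| => q0.
  set N := n.+1%:R * (2 * `|x| + 1); have N0 : 0 < N.
    by rewrite mulr_gt0 ?ltr0n //; have := normr_ge0 x; lra.
  have e0 : 0 < Num.min 1 (q / (2 * N)).
    by rewrite lt_min ltr01 divr_gt0 ?mulr_gt0.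
  have [u [Xu uM ue]] := far (1 + 2 * `|c| / q) _ e0.
  move: ue; rewrite lt_min => /andP[u1]; rewrite ltr_pdivlMr ?mulr_gt0 // => u2.
  have := norm_qform_sub u1; rewrite qform_hat (Xc _ Xu).2 -/N.
  have c0 : 0 <= 2 * `|c| / q by rewrite divr_ge0 ?mulr_ge0 // ltW.
  have s1 : 1 <= `|xlast u| by lra.
  have : `|c / xlast u ^+ 2| < q / 2.
    rewrite normrM normfV normrX ltr_pdivrMr; last by apply: exprn_gt0; lra.
    have : 2 * `|c| < q * `|xlast u|.
      by rewrite -ltr_pdivrMl // mulrC; lra.
    have : q * `|xlast u| <= q * `|xlast u| ^+ 2.
      by rewrite ler_pM2l // expr2 ler_peMl //; lra.
    by lra.
  have := lerB_dist (qform x) (c / xlast u ^+ 2); rewrite -/q distrC.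
  by move: u2; rewrite /N; lra.
move=> U /nbhs_ballP [e /= e0 eU].
have e2 : 0 < e / 2 by lra.
(* With s = |xlast u| and |xlast v| >= r s, [norm_hat_sub] gives at most C / s^2. The threshold
   below makes s > 1, hence s <= s^2, and C / s^2 < (e/2)^2. *)
pose C := `|c| + `|d| / r ^+ 2 + 2 * b / r.
have [u [Xu uM ue]] := far (1 + 4 * `|C| / e ^+ 2) (e / 2) e2.
have C0 : 0 <= 4 * `|C| / e ^+ 2 by rewrite divr_ge0 ?sqr_ge0 ?mulr_ge0 ?ler0n ?normr_ge0.
have [v [Yv rv Bb]] := part _ Xu.
have [u0 qu] := Xc _ Xu; have qv := Yd _ Yv.
set s := `|xlast u| in uM rv.
have s1 : 1 < s by lra.
have s0 : 0 < s by lra.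
have rs0 : 0 < r * s by rewrite mulr_gt0.
have t0 : 0 < `|xlast v| by lra.
have v0 : xlast v != 0 by rewrite -normr_gt0.
exists (hat v); split.
(* The new point differs from x because q(hat v) is nonzero, as d is, whereas q x = 0. *)
- apply/eqP => vx; have := qform_hat v; rewrite vx qx qv => /esym/eqP.
  by rewrite mulf_eq0 invr_eq0 expf_eq0 (negPf d0) (negPf v0).
- by exists v.
apply: eU; rewrite -ball_normE /ball_ /=.
have -> : x - hat v = (hat u - hat v) - (hat u - x) by rewrite opprB [RHS]addrC subrKA.
apply: le_lt_trans (ler_normB _ _) _.
suff : `|hat u - hat v| < e / 2 by lra.
rewrite -(@ltr_pXn2r _ 2) ?nnegrE ?(ltW e2) //.
apply: le_lt_trans (norm_hat_sub u0 v0) _; rewrite qu qv.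
have b0 : 0 <= b by apply: le_trans Bb.
have h1 : c / xlast u ^+ 2 <= `|c| / s ^+ 2.
  rewrite /s -normrX (ger0_norm (sqr_ge0 (xlast u))).
  by apply: ler_wpM2r; rewrite ?invr_ge0 ?sqr_ge0 ?ler_norm.
have h2 : d / xlast v ^+ 2 <= `|d| / r ^+ 2 / s ^+ 2.
  rewrite -mulrA -invfM -exprMn; apply: (@le_trans _ _ (`|d| / xlast v ^+ 2)).
    by apply: ler_wpM2r; rewrite ?invr_ge0 ?sqr_ge0 ?ler_norm.
  apply: ler_wpM2l => //; rewrite lef_pV2 ?posrE ?(exprn_gt0 2 rs0) ?exprn_even_gt0 //.
  by rewrite -[leRHS]real_normK ?num_real // lerXn2r ?nnegrE // ltW.
have h3 : - (2 * (Bform u v / (xlast u * xlast v))) <= 2 * b / r / s ^+ 2.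
  have -> : 2 * b / r / s ^+ 2 = 2 * (b * (r * s ^+ 2)^-1) by rewrite (invfM r) !mulrA.
  rewrite -mulrN ler_pM2l // -mulNr; apply: le_trans (ler_norm _) _.
  rewrite normrM normrN normfV normrM -/s.
  apply: ler_pM => //; first by rewrite invr_ge0 mulr_ge0 // ltW.
  rewrite lef_pV2 ?posrE ?mulr_gt0 ?exprn_gt0 //; nra.
have : `|c| / s ^+ 2 + `|d| / r ^+ 2 / s ^+ 2 + 2 * b / r / s ^+ 2 < (e / 2) ^+ 2.
  rewrite -!mulrDl -/C ltr_pdivrMr ?exprn_gt0 //.
  have : 4 * `|C| < e ^+ 2 * s.
    by rewrite -ltr_pdivrMl ?exprn_gt0 // mulrC; lra.
  have := ler_norm C; have : e ^+ 2 * s <= e ^+ 2 * s ^+ 2.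
    by rewrite ler_pM2l ?exprn_gt0 // expr2 ler_peMl //; lra.
  by rewrite exprMn exprVn; lra.
by apply: le_lt_trans; rewrite lerD ?lerD.
Qed.

End LimitPoints.

(** * Comparison of the orbit with the roots *)

Section Orbit.
Set Implicit Arguments.
Unset Strict Implicit.
Unset Printing Implicit Defensive.
Context {R : realType} {n : nat}.
Local Notation V := 'rV[R]_(n.+1).
Variables (D : seq V) (x0 : V).
Hypothesis D_unit : forall a, a \in D -> Bform a a = 1.
Hypothesis D_cox : forall a b, a \in D -> b \in D -> a != b -> Coxeter_pair a b.
Hypothesis D_pos : forall a, a \in D -> 0 < xlast a.
Hypothesis D_span : span_all D.
Hypothesis x0_neg : qform x0 < 0.
Implicit Types (a b u v : V) (ws : seq V).

Definition orbit_vect : set V := [set wact ws x0 | ws in [set ws | all (mem D) ws]].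

Lemma orbit_vect_qform u : orbit_vect u -> qform u = qform x0.
Proof. by case=> ws /allP wD <-; apply/Bform_wact/(sub_unit_word D_unit). Qed.

Lemma qform_neg_xlast u : qform u < 0 -> xlast u != 0.
Proof.
apply: contraTneq => u0; rewrite -leNgt.
by have := norm_sqr_le u; rewrite u0 expr0n /= mulr0 addr0; apply: le_trans; exact: sqr_ge0.
Qed.

(* With [p] the ratio of the last coordinates, the nonnegativity of the left
   side of [norm_hat_sub] reads [- qform v <= p ^ 2 + 2 B p]. *)
Lemma root_xlast_le u v (B : R) : qform u = 1 -> qform v < 0 -> `|Bform u v| <= B ->
  Num.min 1 (- qform v / (1 + 2 * B)) * `|xlast u| <= `|xlast v|.
Proof.
move=> qu qv HB; have v0 := qform_neg_xlast qv.
have B0 : 0 <= B by apply: le_trans HB.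
have [u0|u0] := eqVneq (xlast u) 0; first by rewrite u0 normr0 mulr0.
have s0 : 0 < `|xlast u| by rewrite normr_gt0.
have t0 : 0 < `|xlast v| by rewrite normr_gt0.
(* If p >= 1 the minimum with 1 suffices; otherwise p^2 <= p, and the quadratic bound becomes
   linear. *)
rewrite -ler_pdivlMr // ge_min -implyNb -ltNge; apply/implyP.
set p := `|xlast v| / `|xlast u| => p1.
have p0 : 0 < p by rewrite divr_gt0.
rewrite ler_pdivrMr; last by lra.
have := le_trans (sqr_ge0 _) (norm_hat_sub u0 v0); rewrite qu => h.
have {}h : 0 <= p ^+ 2 + qform v - 2 * (Bform u v * (xlast v / xlast u)).
  have -> : p ^+ 2 = xlast v ^+ 2 / xlast u ^+ 2.
    by rewrite /p -normf_div real_normK ?num_real // expr_div_n.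
  have := mulr_ge0 h (sqr_ge0 (xlast v)).
  set L := _ * _; set L' := (X in _ -> 0 <= X).
  by have -> : L = L'; rewrite /L /L' //; field; rewrite u0 v0.
have : - (Bform u v * (xlast v / xlast u)) <= B * p.
  rewrite -mulNr; apply: le_trans (ler_norm _) _.
  rewrite normrM normrN normf_div -/p.
  by apply: ler_wpM2r => //; exact: ltW.
by nra.
Qed.

Let Bmax := \sum_(a <- D) `|Bform a x0|.

Lemma Bform_le_sum a : a \in D -> `|Bform a x0| <= Bmax.
Proof.
move=> aD; rewrite /Bmax (big_rem a) //= lerDl sumr_ge0 // => b _; exact: normr_ge0.
Qed.

Lemma Bform_wact_le ws a : {subset ws <= D} -> a \in D ->
  `|Bform (wact ws a) (wact ws x0)| <= Bmax.
Proof. by move=> wD aD; rewrite Bform_wact ?Bform_le_sum //; exact: sub_unit_word wD. Qed.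

Let r := Num.min 1 (- qform x0 / (1 + 2 * Bmax)).

Lemma r_gt0 : 0 < r.
Proof.
have B0 : 0 <= Bmax by apply: sumr_ge0.
by rewrite /r lt_min ltr01 divr_gt0 ?oppr_gt0 // ltr_pwDl // mulr_ge0.
Qed.

(** Neither q(w x0) nor B(w a, w x0) depends on w, so one constant r serves the whole group. *)
Lemma wact_xlast_le ws a : {subset ws <= D} -> a \in D ->
  r * `|xlast (wact ws a)| <= `|xlast (wact ws x0)|.
Proof.
move=> wD aD; have uw := sub_unit_word D_unit wD.
have qE : qform (wact ws x0) = qform x0 by exact: Bform_wact.
rewrite /r -qE; apply: root_xlast_le; rewrite ?qE //.
- by rewrite /qform Bform_wact // D_unit.
- exact: Bform_wact_le.
Qed.

Lemma sum_image_finite (F : set V) (lam : V -> R) (s : seq V) : finite_set F ->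
  finite_set [set v | exists2 f : V -> V, (forall a, a \in s -> F (f a)) &
                      v = \sum_(a <- s) lam a *: f a].
Proof.
move=> finF; elim: s => [|a s IH].
  by apply: (@sub_finite_set _ _ [set 0]); last exact: finite_set1;
     move=> v [f _ ->]; rewrite big_nil.
apply: sub_finite_set (finite_image2 (fun u v => lam a *: u + v) finF IH).
move=> v [f Ff ->]; rewrite big_cons; exists (f a); first by apply: Ff; rewrite mem_head.
exists (\sum_(j <- s) lam j *: f j) => //; exists f => // b bs.
by apply: Ff; rewrite inE bs orbT.
Qed.

(** Writing x0 in the simple roots makes w x0 a fixed combination of the w a, which lie in a finite
    set of roots by [wact_xlast_le]. *)
Lemma orbit_vect_finite (M : R) : finite_set [set u | orbit_vect u /\ `|xlast u| <= M].
Proof.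
have [lam xE] := D_span x0.
have finF := roots_finite D_unit D_cox D_pos (M / r).
apply: sub_finite_set (sum_image_finite lam D finF).
move=> _ [[ws wD <-] wM]; exists (wact ws); last first.
  by rewrite {1}xE linear_sum; apply: eq_bigr => a _; rewrite linearZ.
move=> a aD; split; first by exists ws, a.
rewrite ler_pdivlMr ?r_gt0 // mulrC; apply: le_trans wM.
by apply: wact_xlast_le => //; apply/allP.
Qed.

Lemma orbit_partner : exists2 r', 0 < r' & forall u, orbit_vect u ->
  exists b, [/\ Defs.roots D b, r' * `|xlast u| <= `|xlast b| & `|Bform u b| <= Bmax].
Proof.
have [lam xE] := D_span x0.
(* The summand 1 makes L exceed the sum of the |lam a|; if every |xlast (w a)| were below t / L,
   then t < t would follow. *)
pose L := 1 + \sum_(a <- D) `|lam a|.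
have L1 : 1 <= L by rewrite lerDl sumr_ge0.
have L0 : 0 < L by lra.
exists L^-1; first by rewrite invr_gt0.
move=> _ [ws wD <-]; have sub : {subset ws <= D} by apply/allP.
set t := `|xlast (wact ws x0)|.
have t0 : 0 < t.
  by rewrite normr_gt0 qform_neg_xlast // /qform Bform_wact //; exact: sub_unit_word sub.
have [/hasP [a aD ha]|/hasPn no] := boolP (has (fun a => L^-1 * t <= `|xlast (wact ws a)|) D).
  by exists (wact ws a); split => //; [exists ws, a | rewrite BformC Bform_wact_le].
suff : t < t by rewrite ltxx.
apply: (@le_lt_trans _ _ (\sum_(a <- D) `|lam a| * (L^-1 * t))).
  rewrite /t {1}xE !linear_sum /=; apply: le_trans (ler_norm_sum _ _ _) _.
  rewrite big_seq [leRHS]big_seq; apply: ler_sum => a aD.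
  rewrite !linearZ /= normrM; apply: ler_wpM2l => //.
  by apply: ltW; rewrite ltNge; exact: no.
rewrite -mulr_suml mulrA gtr_pMl // ltr_pdivrMr // mul1r /L; lra.
Qed.

Lemma limit_orbit_eq : limit_set_from D x0 = limit_roots D.
Proof.
have orbE : Defs.orbit D x0 = (@hat R n) @` [set u | orbit_vect u /\ xlast u != 0].
  apply/seteqP; split => [_ [ws wD <-]|_ [_ [[ws wD <-] _] <-]]; last by exists ws.
  exists (wact ws x0) => //; have ou : orbit_vect (wact ws x0) by exists ws.
  by split => //; apply: qform_neg_xlast; rewrite orbit_vect_qform.
rewrite /limit_set_from /limit_roots orbE; apply/seteqP; split.
  have [r' r'0 part] := orbit_partner.
  (* From orbit to roots: c = q x0 and d = 1. *)
  have := @limit_point_transfer R n [set u | orbit_vect u /\ xlast u != 0]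
    (Defs.roots D) (qform x0) 1 Bmax r' r'0 (oner_neq0 _).
  apply => [u [ou u0]|v /(roots_unit D_unit)//|M|u [ou _]]; last exact: part.
    by rewrite orbit_vect_qform.
  by apply: sub_finite_set (orbit_vect_finite M) => u [[ou _] uM].
(* From roots to orbit: c = 1 and d = q x0, nonzero since x0 is timelike. *)
have := @limit_point_transfer R n [set b | Defs.roots D b /\ xlast b != 0]
  orbit_vect 1 (qform x0) Bmax r r_gt0 (ltr0_neq0 x0_neg).
apply => [u [/(roots_unit D_unit) qu u0]|v|M|_ [[ws [a [wD aD ->]]] _]].
- by [].
- exact: orbit_vect_qform.
- by apply: sub_finite_set (roots_finite D_unit D_cox D_pos M) => u [[ou _] uM].
have sub : {subset ws <= D} by apply/allP.
by exists (wact ws x0); split; [exists ws | exact: wact_xlast_le | exact: Bform_wact_le].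
Qed.

End Orbit.

Theorem theorem3p3 (R : realType) (n : nat) (Delta : seq 'rV[R]_(n.+1)) :
  simple_system Delta ->
  span_all Delta ->
  (forall b, pos_roots Delta b -> xlast b != 0) ->
  (forall a, a \in Delta -> Bform (elast R n) a < 0) ->
  forall x0, proj_model x0 -> limit_set_from Delta x0 = limit_roots Delta.
Proof.
move=> [_ _ cox unit] span _ neg x0 [_ x0_neg].
apply: limit_orbit_eq => // a aD.
(* As B(e_(n+1), a) = - xlast a, the sign hypothesis says that [xlast] is positive on the simple
   roots. *)
by rewrite -oppr_lt0 -Bform_elast neg.
Qed.
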